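(* Suppose $p$ in $\mathbb{Z}$ is a prime congruent to $2$ or $5$ modulo $9$. Then neither $\beta p$ nor $\beta p^{2}$ is of the form $x^{3}+y^{3}$ with $x$ and $y$ in $\mathcal{K}$.
   Context: Let $u$ and $v$ be the two roots in $\mathbb{C}$ of $z^{2}+z+1=0$ (so $u,v$ are the primitive cube roots of unity), and $\beta=u-v$ (so $\beta^2=-3$). $\mathcal{K}$ is the field of $\mathbb{Q}$-linear combinations of $1,u,v$. *)

(* Defs.v *)
From mathcomp Require Import all_boot all_order all_algebra.
From mathcomp Require Import reals complex.

Set Implicit Arguments.
Unset Strict Implicit.
Unset Printing Implicit Defensive.

Import GRing.Theory.
Local Open Scope ring_scope.

(* [u] and [v] are the two roots of z^2 + z + 1, in either order; the
   equivalence makes them distinct because the polynomial is separable. *)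
Definition are_the_two_roots (R : realType) (u v : R[i]) : Prop :=
  forall z : R[i], z ^+ 2 + z + 1 = 0 <-> z = u \/ z = v.

Definition in_K (R : realType) (u v z : R[i]) : Prop :=
  exists a b c : rat, z = ratr a + ratr b * u + ratr c * v.

Definition sum_of_two_cubes_in (R : realType) (K : R[i] -> Prop) (z : R[i]) :
    Prop :=
  exists x y : R[i], [/\ K x, K y & z = x ^+ 3 + y ^+ 3].

(* Main.v *)
(** Write w = u and work in Z[w], which is Euclidean. With a = x + y,
    b = w x + w^2 y, c = w^2 x + w y, a solution of x^3 + y^3 = q z^3, where
    q = beta p^k, becomes a + b + c = 0 and abc = q z^3. We descend on the norm
    of z. A prime dividing two of a, b, c divides all three and can be removed
    because q is cube-free. Otherwise unique factorization writes a, b, c as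
    cubes times factors of q; both beta and p are prime (p is inert), so up to
    units the coefficients are (1, 1, beta p^k) or (1, p^k, beta). Cubes prime
    to beta are 1 or -1 modulo 9 = beta^4, and p^k is 2, 4, 5 or 7 modulo 9:
    this excludes the second form, and forces the first one to be again
    X^3 + Y^3 = q Z^3 with Z dividing z. The triple (a, b, c) attached to
    (X, Y) is divisible by beta, so removing beta makes the norm drop. *)
From HB Require Import structures.
Require Import Defs.
From mathcomp Require Import all_boot all_order all_algebra finfield.
From mathcomp Require Import reals complex boolp.
From mathcomp Require Import zify ring.

Set Implicit Arguments.
Unset Strict Implicit.
Unset Printing Implicit Defensive.

Import Order.TTheory GRing.Theory Num.Theory.
Local Open Scope ring_scope.

(** * The ring of Eisenstein integers *)

(* [Eis a b] stands for a + b w, where w^2 = -1 - w. *)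
Record eis := Eis { re : int; im : int }.

Definition eis_pair (x : eis) : int * int := (re x, im x).
Definition pair_eis (x : int * int) : eis := Eis x.1 x.2.
Lemma eis_pairK : cancel eis_pair pair_eis. Proof. by case. Qed.
HB.instance Definition _ := Choice.copy eis (can_type eis_pairK).

Lemma eis_eq (x y : eis) : re x = re y -> im x = im y -> x = y.
Proof. by case: x y => [a b] [c d] /= -> ->. Qed.

Definition eis_add (x y : eis) := Eis (re x + re y) (im x + im y).
Definition eis_opp (x : eis) := Eis (- re x) (- im x).
Definition eis_mul (x y : eis) :=
  Eis (re x * re y - im x * im y) (re x * im y + im x * re y - im x * im y).

Fact eis_addA : associative eis_add.
Proof. by move=> x y z; apply: eis_eq => /=; ring. Qed.
Fact eis_addC : commutative eis_add.
Proof. by move=> x y; apply: eis_eq => /=; ring. Qed.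
Fact eis_add0 : left_id (Eis 0 0) eis_add.
Proof. by move=> x; apply: eis_eq => /=; ring. Qed.
Fact eis_addN : left_inverse (Eis 0 0) eis_opp eis_add.
Proof. by move=> x; apply: eis_eq => /=; ring. Qed.
HB.instance Definition _ :=
  GRing.isZmodule.Build eis eis_addA eis_addC eis_add0 eis_addN.

Fact eis_mulA : associative eis_mul.
Proof. by move=> x y z; apply: eis_eq => /=; ring. Qed.
Fact eis_mulC : commutative eis_mul.
Proof. by move=> x y; apply: eis_eq => /=; ring. Qed.
Fact eis_mul1 : left_id (Eis 1 0) eis_mul.
Proof. by move=> x; apply: eis_eq => /=; ring. Qed.
Fact eis_mulD : left_distributive eis_mul +%R.
Proof. by move=> x y z; apply: eis_eq => /=; ring. Qed.
Fact eis_neq : Eis 1 0 != 0. Proof. by []. Qed.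
HB.instance Definition _ :=
  GRing.Zmodule_isComNzRing.Build eis eis_mulA eis_mulC eis_mul1 eis_mulD eis_neq.

Lemma reD x y : re (x + y) = re x + re y. Proof. by []. Qed.
Lemma imD x y : im (x + y) = im x + im y. Proof. by []. Qed.
Lemma reN x : re (- x) = - re x. Proof. by []. Qed.
Lemma imN x : im (- x) = - im x. Proof. by []. Qed.
Lemma reM x y : re (x * y) = re x * re y - im x * im y. Proof. by []. Qed.
Lemma imM x y : im (x * y) = re x * im y + im x * re y - im x * im y.
Proof. by []. Qed.
Lemma re_nat n : re n%:R = n%:Z.
Proof. by elim: n => [|n IH] //; rewrite -addn1 natrD reD IH PoszD. Qed.
Lemma im_nat n : im n%:R = 0.
Proof. by elim: n => [|n IH] //; rewrite -addn1 natrD imD IH. Qed.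

Definition eisE := (reD, imD, reN, imN, reM, imM, re_nat, im_nat).

(** * Norm, conjugation and units *)

Definition norm (x : eis) : int := re x ^+ 2 - re x * im x + im x ^+ 2.
(** Complex conjugation, which sends w to w^2 = -1 - w. *)
Definition conj (x : eis) : eis := Eis (re x - im x) (- im x).

Lemma normM x y : norm (x * y) = norm x * norm y.
Proof. by rewrite /norm !eisE; ring. Qed.
Lemma mul_conj x : x * conj x = Eis (norm x) 0.
Proof. by apply: eis_eq; rewrite !eisE /norm /=; ring. Qed.
Lemma norm_conj x : norm (conj x) = norm x.
Proof. by rewrite /norm /=; ring. Qed.
(** Complete the square: four times the norm is (2 [re x] - [im x])^2 + 3 ([im x])^2. *)
Lemma norm_ge0 x : 0 <= norm x.
Proof.
have := sqr_ge0 (2 * re x - im x); have := sqr_ge0 (im x).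
rewrite /norm !expr2; nia.
Qed.
Lemma norm_eq0 x : (norm x == 0) = (x == 0).
Proof.
apply/eqP/eqP => [h|-> //].
have h1 := sqr_ge0 (2 * re x - im x); have h2 := sqr_ge0 (2 * im x - re x).
by apply: eis_eq; move: h h1 h2; rewrite /norm !expr2 /=; nia.
Qed.
Lemma norm_gt0 x : (0 < norm x) = (x != 0).
Proof. by rewrite lt_neqAle norm_ge0 andbT eq_sym norm_eq0. Qed.

Definition eis_unit : pred eis := [pred x | norm x == 1].
Definition eis_inv (x : eis) := if norm x == 1 then conj x else x.
Fact eis_mulVr : {in eis_unit, left_inverse 1 eis_inv *%R}.
Proof.
by move=> x; rewrite inE /eis_inv => /eqP h; rewrite h eqxx mulrC mul_conj h.
Qed.
Fact eis_unitP x y : y * x = 1 -> eis_unit x.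
Proof.
move=> /(congr1 norm); rewrite normM => h; apply/eqP.
have n1 : norm 1 = 1 by [].
move: h (norm_ge0 x) (norm_ge0 y); rewrite n1.
by case: (norm x) (norm y) => [[|[|m]]|m] [[|[|n]]|n] //=; lia.
Qed.
Fact eis_inv_out : {in [predC eis_unit], eis_inv =1 id}.
Proof. by move=> x; rewrite !inE /eis_inv => /negbTE ->. Qed.
HB.instance Definition _ :=
  GRing.ComNzRing_hasMulInverse.Build eis eis_mulVr eis_unitP eis_inv_out.

Fact eis_integral (x y : eis) : x * y = 0 -> (x == 0) || (y == 0).
Proof.
move=> /(congr1 norm)/eqP; rewrite normM mulf_eq0.
by rewrite !norm_eq0.
Qed.
HB.instance Definition _ := GRing.ComUnitRing_isIntegral.Build eis eis_integral.

Lemma unit_norm (x : eis) : (x \is a GRing.unit) = (norm x == 1).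
Proof. by []. Qed.

(** * Divisibility, Euclidean division and primes *)

Definition edvd (a b : eis) := exists c, b = c * a.

Lemma edvdxx a : edvd a a. Proof. by exists 1; rewrite mul1r. Qed.
Lemma edvd_mull a b c : edvd a b -> edvd a (c * b).
Proof. by case=> t ->; exists (c * t); rewrite mulrA. Qed.
Lemma edvd_mulr a b c : edvd a b -> edvd a (b * c).
Proof. by rewrite mulrC; apply: edvd_mull. Qed.
Lemma edvd_trans a b c : edvd a b -> edvd b c -> edvd a c.
Proof. by move=> ab [t ->]; apply: edvd_mull. Qed.
Lemma edvdD a b c : edvd a b -> edvd a c -> edvd a (b + c).
Proof. by move=> [s ->] [t ->]; exists (s + t); rewrite mulrDl. Qed.
Lemma edvdN a b : edvd a b -> edvd a (- b).
Proof. by move=> [s ->]; exists (- s); rewrite mulNr. Qed.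

Lemma int_round (c n : int) : 0 < n ->
  exists q r : int, c = q * n + r /\ - n <= 2 * r <= n.
Proof.
(* The nearest integer to c / n, as the floor of c / n + 1 / 2. *)
move=> n0; exists ((2 * c + n) %/ (2 * n))%Z.
exists (c - ((2 * c + n) %/ (2 * n))%Z * n); split; first by ring.
have n20 : 2 * n != 0 by lia.
have h1 := divz_eq (2 * c + n) (2 * n).
have h2 := modz_ge0 (2 * c + n) n20.
have h3 := ltz_pmod (2 * c + n) (d := 2 * n) ltac:(lia).
by move: h1 h2 h3; set q := (_ %/ _)%Z; set r := (_ %% _)%Z; nia.
Qed.

(** Round both coordinates of a / b = a [conj b] / [norm b]. The remainder times [conj b] has
    coordinates of size at most half of n = [norm b], so norm at most 3 n^2 / 4, and [norm (conj b)]
    = n cancels. *)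
Lemma euclid (a b : eis) : b != 0 -> exists q, norm (a - q * b) < norm b.
Proof.
rewrite -norm_gt0 => b0.
have [q1 [r1 [e1 l1]]] := int_round (re (a * conj b)) b0.
have [q2 [r2 [e2 l2]]] := int_round (im (a * conj b)) b0.
exists (Eis q1 q2).
have E : (a - Eis q1 q2 * b) * conj b = Eis r1 r2.
  rewrite mulrBl -mulrA mul_conj; apply: eis_eq.
  - by rewrite reD e1 reN reM /=; ring.
  - by rewrite imD e2 imN imM /=; ring.
move: (congr1 norm E); rewrite normM norm_conj => {}E.
move: b0 l1 l2 E; rewrite [norm (Eis r1 r2)]/norm /=.
move: (norm (a - _)) (norm b) => m n n0 l1 l2 E.
have : m * n < n * n by rewrite E; nia.
by rewrite ltr_pM2r.
Qed.

Lemma bezout (a b : eis) :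
  exists g s t, [/\ g = s * a + t * b, edvd g a & edvd g b].
Proof.
have [n] := ubnP `|norm b|%N; elim: n => // n IH in a b *.
move=> ltn; have [->|b0] := eqVneq b 0.
  by exists a, 1, 0; split; [ring|apply: edvdxx|exists 0; rewrite mul0r].
have [q lq] := euclid a b0.
have [|g [s [t [e ga gb]]]] := IH b (a - q * b).
  by move: (norm_ge0 (a - q * b)) (norm_ge0 b) ltn lq; lia.
exists g, t, (s - t * q); split=> //; first by rewrite e; ring.
by rewrite -(subrK (q * b) a); apply: edvdD => //; apply: edvd_mull.
Qed.

Definition is_prime (q : eis) :=
  [/\ q != 0, q \isn't a GRing.unit &
      forall a b, edvd q (a * b) -> edvd q a \/ edvd q b].

Lemma unit_dvd1 x : edvd x 1 <-> x \is a GRing.unit.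
Proof.
split=> [[c e]|ux]; last by exists x^-1; rewrite mulVr.
by apply/unitrPr; exists c; rewrite mulrC -e.
Qed.

Lemma norm_lt_of_nonunit (x y : eis) :
  x != 0 -> y \isn't a GRing.unit -> norm x < norm (x * y) \/ y = 0.
Proof.
rewrite -norm_gt0 unit_norm normM => x0 /eqP y1.
have [->|] := eqVneq y 0; first by right.
by rewrite -norm_gt0; left; nia.
Qed.

(** Pass to non-unit divisors of smaller norm as long as there are any. When none is left, the
    element is prime, by Bezout. *)
Lemma exists_prime_dvd (x : eis) : x != 0 -> x \isn't a GRing.unit ->
  exists2 q, is_prime q & edvd q x.
Proof.
have [n] := ubnP `|norm x|%N; elim: n => // n IH in x *.
move=> ltn x0 ux.
have [[y [[t e] uy ly]]|min] :=
    EM (exists y, [/\ edvd y x, y \isn't a GRing.unit & norm y < norm x]).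
  have y0 : y != 0 by apply: contraNneq x0 => y0; rewrite e y0 mulr0.
  have [|q pq qy] := IH y _ y0 uy.
    by move: (norm_ge0 y) ltn ly; lia.
  by exists q => //; apply: (edvd_trans qy); exists t.
exists x; last exact: edvdxx.
split=> // a b xab.
have [g [s [t [e [h xg] ga]]]] := bezout x a.
(* If the gcd [g] of [x] and [a] is a unit, [b] is a combination of [x] and [a * b]. Otherwise
   minimality makes [g] an associate of [x], so [x] divides [a]. *)
have [ug|nug] := boolP (g \is a GRing.unit).
  right; rewrite -[b](mulKr ug) e; apply: edvd_mull.
  have -> : (s * x + t * a) * b = (s * b) * x + t * (a * b) by ring.
  by apply: edvdD; apply: edvd_mull => //; apply: edvdxx.
left; have g0 : g != 0 by apply: contraNneq x0 => g0; rewrite xg g0 mulr0.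
have [uh|nuh] := boolP (h \is a GRing.unit).
  by apply: edvd_trans ga; exists h^-1; rewrite xg mulKr.
case: min; exists g; split=> //; first by exists h.
have [|h0] := norm_lt_of_nonunit g0 nuh; first by rewrite mulrC -xg.
by move: x0; rewrite xg h0 mul0r eqxx.
Qed.

Lemma prime_dvd_exp q (n : nat) x : is_prime q -> edvd q (x ^+ n) -> edvd q x.
Proof.
move=> [_ uq pq]; elim: n => [|n IH].
  by move/unit_dvd1; rewrite (negbTE uq).
by rewrite exprS => /pq[].
Qed.

Lemma prime_dvd_prime q r : is_prime q -> is_prime r -> edvd q r -> edvd r q.
Proof.
move=> [q0 uq _] [r0 ur pr] [t e].
have [||//] := pr t q; first by rewrite -e; apply: edvdxx.
move=> [s et]; case/negP: uq; apply/unitrPr; exists s; rewrite mulrC.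
by apply: (mulIf r0); rewrite mul1r {2}e et; ring.
Qed.

(** Peel off the factors [q] one at a time: each must come out of [x]. *)
Lemma prime_pow_dvd q (n : nat) x y :
  is_prime q -> ~ edvd q y -> edvd (q ^+ n) (x * y) -> edvd (q ^+ n) x.
Proof.
move=> [q0 uq pq] qy; elim: n x => [|n IH] x.
  by move=> _; exists x; rewrite mulr1.
rewrite exprS => -[t e].
have [[s es]|//] : edvd q x \/ edvd q y.
  by apply: pq; rewrite e mulrCA; apply: edvd_mulr; apply: edvdxx.
have [r er] : edvd (q ^+ n) s.
  apply: IH; exists t; apply: (mulIf q0).
  by rewrite mulrAC -es e; ring.
by exists r; rewrite es er; ring.
Qed.

(** The whole of [q ^+ n] divides [y]; cancelling it leaves an inverse of [x]. *)
Lemma prime_cofactor_unit q (n : nat) x y :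
  is_prime q -> x * y = q ^+ n -> ~ edvd q x -> x \is a GRing.unit.
Proof.
move=> pq e qx; have [t et] : edvd (q ^+ n) y.
  by apply: (prime_pow_dvd pq qx); rewrite mulrC e; apply: edvdxx.
have [q0 _ _] := pq.
apply/unitrPr; exists t; apply: (mulIf (expf_neq0 n q0)).
by rewrite mul1r -[RHS]e et mulrA.
Qed.

(** * Zero-sum triples whose product is q times a cube *)

Definition cubefree (q : eis) := forall r, is_prime r -> ~ edvd (r ^+ 3) q.

Lemma prime_dvd_cube_root q r x :
  cubefree q -> is_prime r -> edvd (r ^+ 3) (q * x ^+ 3) -> edvd r x.
Proof.
move=> cq pr h; have [//|rx] := EM (edvd r x); case: (cq r pr).
by apply: (prime_pow_dvd pr _ h) => /(prime_dvd_exp pr).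
Qed.

Definition sol (q a b c d : eis) :=
  [/\ a + b + c = 0, a * b * c = q * d ^+ 3 & d != 0].

(** The zero sum makes [r] divide [c] too, so [r ^+ 3] divides [q * d ^+ 3] and, [q] being
    cube-free, [r] divides [d]. Divide everything by [r]. *)
Lemma sol_common_prime q a b c d r :
    cubefree q -> is_prime r -> sol q a b c d -> edvd r a -> edvd r b ->
  exists a' b' c' d', sol q a' b' c' d' /\ norm d' < norm d.
Proof.
move=> cq pr [s0 e d0] [a' ea] [b' eb].
have [r0 ur _] := pr.
have ec : c = - (a' + b') * r.
  by rewrite -[LHS]subr0 -s0 ea eb; ring.
have [d' ed] : edvd r d.
  apply: (prime_dvd_cube_root cq pr); exists (a' * b' * - (a' + b')).
  by rewrite -e ea eb ec; ring.
exists a', b', (- (a' + b')), d'; split; first split.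
- by ring.
- apply: (mulIf (expf_neq0 3 r0)).
  have -> : q * d' ^+ 3 * r ^+ 3 = q * d ^+ 3 by rewrite ed; ring.
  by rewrite -e ea eb ec; ring.
- by apply: contraNneq d0 => h; rewrite ed h mul0r.
have d'0 : d' != 0 by apply: contraNneq d0 => h; rewrite ed h mul0r.
have [|h] := norm_lt_of_nonunit d'0 ur; first by rewrite -ed.
by rewrite h eqxx in r0.
Qed.

Definition coprime_pair a b := forall r, is_prime r -> ~ (edvd r a /\ edvd r b).

Lemma coprime_pair_dvd a b a' b' :
  coprime_pair a b -> edvd a' a -> edvd b' b -> coprime_pair a' b'.
Proof.
move=> h ha hb r pr [ra rb]; apply: (h r pr).
by split; [apply: edvd_trans ha|apply: edvd_trans hb].
Qed.

Definition cube_split (q a b c d : eis) :=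
  exists a1 b1 c1 x y z,
    [/\ a = a1 * x ^+ 3, b = b1 * y ^+ 3, c = c1 * z ^+ 3,
        a1 * b1 * c1 = q & d = x * y * z].

Lemma cube_splitC q a b c d : cube_split q b a c d -> cube_split q a b c d.
Proof.
move=> [a1 [b1 [c1 [x [y [z [-> -> -> <- ->]]]]]]].
by exists b1, a1, c1, y, x, z; split=> //; ring.
Qed.

Lemma cube_splitCA q a b c d : cube_split q c b a d -> cube_split q a b c d.
Proof.
move=> [a1 [b1 [c1 [x [y [z [-> -> -> <- ->]]]]]]].
by exists c1, b1, a1, z, y, x; split=> //; ring.
Qed.

(** Unique factorization by induction on the norm of [d]: a prime [r] of [d] divides exactly one of
    the three factors, so [r ^+ 3] divides that factor and [r] goes into its cube root. *)
Lemma coprime_cube_split q a b c d :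
    coprime_pair a b -> coprime_pair a c -> coprime_pair b c ->
    a * b * c = q * d ^+ 3 -> d != 0 ->
  cube_split q a b c d.
Proof.
have [n] := ubnP `|norm d|%N; elim: n => // n IH in a b c d *.
move=> ltn ab ac bc e d0.
have [ud|nud] := boolP (d \is a GRing.unit).
  (* For a unit [d], put [d] into the first cube root, compensate in the coefficient, and take 1 for
     the other roots. *)
  exists (a * d^-1 ^+ 3), b, c, d, 1, 1.
  have dd : d^-1 ^+ 3 * d ^+ 3 = 1 by rewrite -exprMn mulVr ?expr1n.
  split; rewrite ?expr1n ?mulr1 //.
    by rewrite -mulrA dd mulr1.
  have -> : a * d^-1 ^+ 3 * b * c = d^-1 ^+ 3 * (a * b * c) by ring.
  by rewrite e mulrCA dd mulr1.
have [r pr [d' ed]] := exists_prime_dvd d0 nud.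
have [r0 ur prr] := pr.
have d'0 : d' != 0 by apply: contraNneq d0 => h; rewrite ed h mul0r.
have ltd : norm d' < norm d.
  have [|h] := norm_lt_of_nonunit d'0 ur; first by rewrite -ed.
  by rewrite h eqxx in r0.
have ltn' : (`|norm d'| < n)%N.
  by move: (norm_ge0 d') (norm_ge0 d) ltn ltd; lia.
(* [main] is the case where [r] divides the first factor; permuting the factors gives the other
   two. *)
have main a0 b0 c0 : coprime_pair a0 b0 -> coprime_pair a0 c0 ->
    coprime_pair b0 c0 -> a0 * b0 * c0 = q * d ^+ 3 -> edvd r a0 ->
    cube_split q a0 b0 c0 d.
  move=> ab0 ac0 bc0 e0 ra.
  have rb : ~ edvd r b0 by move=> rb; apply: (ab0 r pr).
  have rc : ~ edvd r c0 by move=> rc; apply: (ac0 r pr).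
  have [a' ea] : edvd (r ^+ 3) a0.
    apply: (prime_pow_dvd pr rb); apply: (prime_pow_dvd pr rc).
    by rewrite e0 ed exprMn; apply/edvd_mull/edvd_mull/edvdxx.
  have a'a : edvd a' a0 by rewrite ea; apply/edvd_mulr/edvdxx.
  have [|||a1 [b1 [c1 [x [y [z [ex ey ez eq eq']]]]]]] :=
      IH a' b0 c0 d' ltn' _ _ bc0 _ d'0.
  - exact: coprime_pair_dvd ab0 a'a (edvdxx _).
  - exact: coprime_pair_dvd ac0 a'a (edvdxx _).
  - apply: (mulIf (expf_neq0 3 r0)).
    have -> : q * d' ^+ 3 * r ^+ 3 = q * d ^+ 3 by rewrite ed; ring.
    by rewrite -e0 ea; ring.
  exists a1, b1, c1, (x * r), y, z; split=> //.
    by rewrite ea ex; ring.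
  by rewrite ed eq'; ring.
have sw x y : coprime_pair x y -> coprime_pair y x.
  by move=> h s ps [sx sy]; apply: (h s ps).
have [] : edvd r (a * b) \/ edvd r c.
  by apply: prr; rewrite e ed; apply/edvd_mull/edvd_mulr/edvd_mull/edvdxx.
- move=> /prr [ra|rb]; first exact: main.
  by apply: cube_splitC; apply: main => //; [apply: sw|rewrite -e; ring].
move=> rc; apply: cube_splitCA; apply: main => //; try exact: sw.
by rewrite -e; ring.
Qed.

(** * The primes beta and p, and cube-freeness of beta p^k *)

Definition omega := Eis 0 1.
(* omega - omega^2 = 1 + 2 omega. *)
Definition beta := Eis 1 2.

(** Modulo beta, w is 1, so [re x + im x] is the residue of [x] in the field with three elements. *)
Lemma beta_dvdP x : edvd beta x <-> (3 %| re x + im x)%Z.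
Proof.
split=> [[c ->]|/dvdzP[k e]].
  by apply/dvdzP; exists (re c - im c); rewrite reM imM /=; ring.
exists (Eis (im x - k) (im x - 2 * k)).
by apply: eis_eq; rewrite ?reM ?imM /=; lia.
Qed.

Lemma dvdz_primeM (p : nat) (m n : int) : prime p ->
  (p %| m * n)%Z -> (p %| m)%Z \/ (p %| n)%Z.
Proof. by move=> pp; rewrite !dvdzE abszM /= Euclid_dvdM // => /orP. Qed.

Lemma beta_prime : is_prime beta.
Proof.
split=> // a b /beta_dvdP h.
have : (3%:Z %| (re a + im a) * (re b + im b))%Z.
  have -> : (re a + im a) * (re b + im b) =
    (re (a * b) + im (a * b)) + 3%:Z * (im a * im b).
    by rewrite reM imM; ring.
  by apply: rpredD => //; apply/dvdz_mulr/dvdzz.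
by move/dvdz_primeM => [] // /beta_dvdP; [left|right].
Qed.

(* x^3 = - y^3, and x, y are powers of their cubes times squares, so
   x y^2 = +- x^2 y, that is, x = +- y when x and y are nonzero. *)
Lemma field_norm_form_eq0 (F : fieldType) (m : nat) (x y : F) :
    3%:R != 0 :> F -> x ^+ (3 * m + 2) = x -> y ^+ (3 * m + 2) = y ->
  x ^+ 2 - x * y + y ^+ 2 = 0 -> x = 0.
Proof.
move=> n3 ex ey h; apply/eqP/negPn/negP => x0.
have cubes : x ^+ 3 = - y ^+ 3.
  apply/eqP; rewrite -subr_eq0; apply/eqP.
  have -> : x ^+ 3 - - y ^+ 3 = (x + y) * (x ^+ 2 - x * y + y ^+ 2) by ring.
  by rewrite h mulr0.
have y0 : y != 0.
  by apply: contraNneq x0 => y0; move: h => /eqP; rewrite y0 mulr0 subr0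
    expr0n addr0 expf_eq0.
have key : x * y ^+ 2 = (-1) ^+ m * (x ^+ 2 * y).
  have ex' : x = (x ^+ 3) ^+ m * x ^+ 2 by rewrite -exprM -exprD ex.
  have ey' : y = (y ^+ 3) ^+ m * y ^+ 2 by rewrite -exprM -exprD ey.
  rewrite {1}ex' {2}ey' cubes -[- _ ^+ 3]mulN1r exprMn; ring.
have : (x - y) * (x + y) = 0.
  apply: (mulfI (mulf_neq0 x0 y0)); rewrite mulr0.
  have : (x * y ^+ 2) ^+ 2 = (x ^+ 2 * y) ^+ 2.
    by rewrite key exprMn -exprM mulnC exprM sqrrN !expr1n mul1r.
  move=> e; apply: (mulfI (mulf_neq0 x0 y0)); rewrite mulr0.
  have -> : x * y * (x * y * ((x - y) * (x + y))) =
    (x ^+ 2 * y) ^+ 2 - (x * y ^+ 2) ^+ 2 by ring.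
  by rewrite e subrr.
move/eqP; rewrite mulf_eq0 => /orP[].
  rewrite subr_eq0 => /eqP exy; move: h; rewrite -exy => /eqP.
  have -> : x ^+ 2 - x * x + x ^+ 2 = x ^+ 2 by ring.
  by rewrite expf_eq0 /= (negbTE x0).
rewrite addr_eq0 => /eqP exy; move: h => /eqP.
have -> : x ^+ 2 - x * y + y ^+ 2 = 3%:R * y ^+ 2 by rewrite exy; ring.
by rewrite mulf_eq0 (negbTE n3) expf_eq0 /= (negbTE y0).
Qed.

Lemma dvd_natP (p : nat) x :
  edvd p%:R x <-> (p %| re x)%Z /\ (p %| im x)%Z.
Proof.
split=> [[c ->]|[/dvdzP[s es] /dvdzP[t et]]].
  by rewrite !eisE; split; apply/dvdzP; [exists (re c)|exists (im c)]; ring.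
by exists (Eis s t); apply: eis_eq; rewrite !eisE /= ?es ?et; ring.
Qed.

(** Over the field with p = 3 m + 2 elements, Fermat's a^p = a supplies the exponents that
    [field_norm_form_eq0] asks for. The form is symmetric, so both coordinates vanish modulo p. *)
Lemma inert_dvd_norm (p : nat) x : prime p -> p = 2 %[mod 3] ->
  (p %| norm x)%Z -> edvd p%:R x.
Proof.
move=> pp p3 h.
have pc : p \in [pchar 'F_p] by exact: pchar_Fp.
have z0 (k : int) : (p %| k)%Z <-> k%:~R = 0 :> 'F_p.
  by rewrite (dvdz_pcharf pc); split=> /eqP.
have fermat (a : 'F_p) : a ^+ (3 * (p %/ 3) + 2) = a.
  have -> : (3 * (p %/ 3) + 2)%N = #|'F_p| by rewrite card_Fp //; lia.
  exact: expf_card.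
have n3 : 3%:R != 0 :> 'F_p.
  rewrite -(dvdn_pcharf pc) (@dvdn_prime2 p 3 pp isT).
  by apply: contraPneq p3 => ->.
have e : (re x)%:~R ^+ 2 - (re x)%:~R * (im x)%:~R + (im x)%:~R ^+ 2 = 0 :> 'F_p.
  by move/z0: h; rewrite /norm rmorphD rmorphB !rmorphXn rmorphM.
apply/dvd_natP; split; apply/z0.
  exact: (field_norm_form_eq0 n3 (fermat _) (fermat _) e).
apply: (field_norm_form_eq0 n3 (fermat _) (fermat _) (y := (re x)%:~R)).
by rewrite -e; ring.
Qed.

Lemma inert_prime (p : nat) : prime p -> p = 2 %[mod 3] -> is_prime p%:R.
Proof.
move=> pp p3; have p1 := prime_gt1 pp.
have np : norm p%:R = p%:Z ^+ 2 by rewrite /norm !eisE; ring.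
split=> [||a b [c e]].
- by rewrite -norm_eq0 np; apply/eqP; nia.
- by rewrite unit_norm np; apply/eqP; nia.
have : (p %| norm a * norm b)%Z.
  rewrite -normM e normM np; apply/dvdz_mull/dvdz_mulr/dvdzz.
by move/(dvdz_primeM pp) => [] /(inert_dvd_norm pp p3); [left|right].
Qed.

Lemma beta_natP (n : nat) : edvd beta n%:R <-> (3 %| n)%N.
Proof. by rewrite beta_dvdP !eisE addr0; split. Qed.

(** A prime whose cube divides the product is an associate of beta or of p. These do not divide each
    other, as 3 does not divide p, and each occurs with exponent below 3. *)
Lemma cubefree_beta_pow (p k : nat) : prime p -> p = 2 %[mod 3] -> (k <= 2)%N ->
  cubefree (beta * p%:R ^+ k).
Proof.
move=> pp p3 k2 r pr h; have ip := inert_prime pp p3.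
have bp := beta_prime; have [p0 up _] := ip; have [b0 ub _] := bp.
have [r0 ur _] := pr.
have cube_not_dvd (s : eis) (n : nat) : is_prime s -> (n <= 2)%N ->
    ~ edvd (s ^+ 3) (s ^+ n).
  move=> [s0 us _] n2 [t e]; case/negP: us; apply/unitrPr.
  exists (t * s ^+ (2 - n)); apply: (mulIf (expf_neq0 n s0)).
  rewrite mul1r [RHS]e.
  have -> : s ^+ 3 = s ^+ 1 * s ^+ (2 - n) * s ^+ n.
    by rewrite -!exprD; congr (_ ^+ _); lia.
  by rewrite expr1; ring.
have [rb|rb] := EM (edvd r beta).
  have [t et] := prime_dvd_prime pr bp rb.
  have nbp : ~ edvd r (p%:R ^+ k).
    move=> /(prime_dvd_exp pr) rp.
    have /beta_natP : edvd beta p%:R by apply: edvd_trans rp; exists t.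
    by move: p3; lia.
  apply: (cube_not_dvd r 1%N pr isT).
  apply: edvd_trans (prime_pow_dvd pr nbp h) _.
  by rewrite expr1; exists t.
have rp : edvd (r ^+ 3) (p%:R ^+ k).
  by apply: (prime_pow_dvd pr rb); rewrite mulrC.
have /(prime_dvd_prime pr ip)[t et] : edvd r p%:R.
  apply: (prime_dvd_exp pr (n := k)); apply: edvd_trans rp.
  by exists (r ^+ 2); rewrite -exprSr.
apply: (cube_not_dvd _ _ ip k2); apply: edvd_trans rp.
by exists (t ^+ 3); rewrite et exprMn.
Qed.

(** * Units, cubes and coefficients modulo 9 *)

(** The sixth roots of unity; [Eis 1 1] is -w^2 and [Eis (-1) (-1)] is w^2. *)
Definition units6 : seq eis :=
  [:: Eis 1 0; Eis 0 1; Eis 1 1; Eis (-1) 0; Eis 0 (-1); Eis (-1) (-1)].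

Lemma unit_units6 x : x \is a GRing.unit -> x \in units6.
Proof.
rewrite unit_norm /norm => /eqP h.
have h1 := sqr_ge0 (2 * re x - im x); have h2 := sqr_ge0 (2 * im x - re x).
have : -1 <= re x <= 1 /\ -1 <= im x <= 1 by move: h h1 h2; rewrite !expr2; nia.
case: x h {h1 h2} => [a b] /= h [ha hb].
have ea : a \in [:: -1; 0; 1] by rewrite !inE; lia.
have eb : b \in [:: -1; 0; 1] by rewrite !inE; lia.
by move: ea eb h; rewrite !inE => /or3P[]/eqP-> /or3P[]/eqP->.
Qed.

(** A boolean test, so that the tables below can be checked by computation. *)
Definition dvd9 (x : eis) := (9 %| re x)%Z && (9 %| im x)%Z.

Lemma dvd9P x : edvd 9%:R x <-> dvd9 x.
Proof. by rewrite (dvd_natP 9); split=> [[h1 h2]|/andP[]//]; apply/andP. Qed.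

Definition signs : seq eis := [:: 1; -1].

(** The cube modulo 9 depends only on [x] modulo 3, which leaves six classes prime to beta to
    inspect. *)
Lemma cube_mod9 x : ~ edvd beta x ->
  exists2 s, s \in signs & edvd 9%:R (x ^+ 3 - s).
Proof.
move=> bx; have [i [j [t [ex li lj]]]] : exists i j t,
    [/\ x = Eis i j + 3%:R * t, 0 <= i <= 2 & 0 <= j <= 2].
  exists (re x %% 3)%Z, (im x %% 3)%Z, (Eis (re x %/ 3)%Z (im x %/ 3)%Z).
  by split; [apply: eis_eq; rewrite !eisE /=|..]; lia.
have nij : ~~ (3 %| i + j)%Z.
  apply/negP => h; apply: bx; apply/beta_dvdP.
  by rewrite ex !eisE /=; move: h; lia.
suff [s hs ds] : exists2 s, s \in signs & dvd9 (Eis i j ^+ 3 - s).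
  exists s => //.
  have -> : x ^+ 3 - s = (Eis i j ^+ 3 - s) +
      (Eis i j ^+ 2 * t + 3%:R * Eis i j * t ^+ 2 + 3%:R * t ^+ 3) * 9%:R.
    by rewrite ex; ring.
  by apply: edvdD; [apply/dvd9P|apply/edvd_mull/edvdxx].
have ei : i \in [:: 0; 1; 2] by rewrite !inE; lia.
have ej : j \in [:: 0; 1; 2] by rewrite !inE; lia.
move: ei ej nij; rewrite !inE {ex li lj}.
(* The surviving (i, j) are (0,1), (0,2), (1,0), (1,1), (2,0), (2,2), in this order. *)
by move=> /or3P[]/eqP-> /or3P[]/eqP-> // _;
  [exists 1|exists (-1)|exists 1|exists (-1)|exists (-1)|exists 1].
Qed.

(** The classes of p and p^2 modulo 9: 2 and 5, with squares 4 and 7. *)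
Definition residues : seq eis := [:: Eis 2 0; Eis 4 0; Eis 5 0; Eis 7 0].

(** The pattern (1, 1, beta p^k): the units agree up to sign and can be cancelled. The residue 1
    would break this, since 1 - w = w^2 beta. *)
Lemma mod9_case_beta_p :
  all (fun e1 => all (fun e2 => all (fun e3 => all (fun s1 => all (fun s2 =>
  all (fun s3 => all (fun m =>
    (e1 * e2 * e3 == 1) ==>
    dvd9 (e1 * s1 + e2 * s2 + e3 * (m * (beta * s3))) ==>
    (e2 \in [:: e1; - e1]) && (e3 \in [:: e1; - e1]))
  residues) (0 :: signs)) signs) signs) units6) units6) units6.
Proof. by vm_compute. Qed.

(** The pattern (1, p^k, beta): no choice of units and cubes survives. *)
Lemma mod9_case_p :
  all (fun e1 => all (fun e2 => all (fun e3 => all (fun s1 => all (fun s2 =>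
  all (fun s3 => all (fun m =>
    (e1 * e2 * e3 == 1) ==>
    ~~ dvd9 (e1 * s1 + e2 * (m * s2) + e3 * (beta * s3)))
  residues) (0 :: signs)) signs) signs) units6) units6) units6.
Proof. by vm_compute. Qed.

Lemma all_in (T : eqType) (P : pred T) s x : all P s -> x \in s -> P x.
Proof. by move/allP => h /h. Qed.

(* If beta divides x, then beta x^3 is a multiple of beta^4 = 9: take s = 0. *)
Lemma beta_cube_mod9 x :
  exists2 s, s \in 0 :: signs & edvd 9%:R (beta * (x ^+ 3 - s)).
Proof.
have [[t ->]|/cube_mod9[s hs ds]] := EM (edvd beta x).
  exists 0 => //; have -> : 9%:R = beta ^+ 4 by apply: eis_eq.
  by exists (t ^+ 3); ring.
by exists s; [rewrite inE hs orbT|apply: edvd_mull].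
Qed.

Lemma residue_mod9 (n : nat) : (n %% 9)%N \in [:: 2; 4; 5; 7]%N ->
  exists2 m, m \in residues & edvd 9%:R (n%:R - m).
Proof.
move=> h; exists (Eis (n %% 9)%N 0).
  by move: h; rewrite !inE => /or4P[]/eqP->.
exists (n %/ 9)%:R; rewrite {1}(divn_eq n 9).
by apply: eis_eq; rewrite !eisE /=; lia.
Qed.

Lemma mod9_beta_p (n : nat) e1 e2 e3 x y z :
    (n %% 9)%N \in [:: 2; 4; 5; 7]%N -> e1 \is a GRing.unit ->
    e2 \is a GRing.unit -> e1 * e2 * e3 = 1 ->
    ~ edvd beta x -> ~ edvd beta y ->
    e1 * x ^+ 3 + e2 * y ^+ 3 + e3 * (n%:R * (beta * z ^+ 3)) = 0 ->
  e2 \in [:: e1; - e1] /\ e3 \in [:: e1; - e1].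
Proof.
move=> /residue_mod9[m hm dm] u1 u2 e123 /cube_mod9[s1 hs1 d1].
move=> /cube_mod9[s2 hs2 d2] e0; have [s3 hs3 d3] := beta_cube_mod9 z.
have u3 : e3 \is a GRing.unit.
  by apply/unitrPr; exists (e1 * e2); rewrite mulrC.
apply/andP.
move: (all_in (all_in (all_in (all_in (all_in
  (all_in (all_in mod9_case_beta_p (unit_units6 u1)) (unit_units6 u2))
  (unit_units6 u3)) hs1) hs2) hs3) hm).
rewrite e123 eqxx implyTb => /implyP; apply.
(* Subtract the equation, whose value is 0: what remains is a combination of the approximation
   errors of the cubes and of [n], all multiples of 9. *)
apply/dvd9P; rewrite -[X in edvd _ X]subr0 -e0.
have -> : e1 * s1 + e2 * s2 + e3 * (m * (beta * s3))
   - (e1 * x ^+ 3 + e2 * y ^+ 3 + e3 * (n%:R * (beta * z ^+ 3)))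
  = - (e1 * (x ^+ 3 - s1) + e2 * (y ^+ 3 - s2)
    + (e3 * m * (beta * (z ^+ 3 - s3)) + e3 * (beta * z ^+ 3) * (n%:R - m))).
  by ring.
by apply/edvdN/edvdD; apply/edvdD; apply: edvd_mull.
Qed.

Lemma mod9_p (n : nat) e1 e2 e3 x y z :
    (n %% 9)%N \in [:: 2; 4; 5; 7]%N -> e1 \is a GRing.unit ->
    e2 \is a GRing.unit -> e1 * e2 * e3 = 1 ->
    ~ edvd beta x -> ~ edvd beta y ->
    e1 * x ^+ 3 + e2 * (n%:R * y ^+ 3) + e3 * (beta * z ^+ 3) <> 0.
Proof.
move=> /residue_mod9[m hm dm] u1 u2 e123 /cube_mod9[s1 hs1 d1].
move=> /cube_mod9[s2 hs2 d2] e0; have [s3 hs3 d3] := beta_cube_mod9 z.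
have u3 : e3 \is a GRing.unit.
  by apply/unitrPr; exists (e1 * e2); rewrite mulrC.
move: (all_in (all_in (all_in (all_in (all_in
  (all_in (all_in mod9_case_p (unit_units6 u1)) (unit_units6 u2))
  (unit_units6 u3)) hs1) hs2) hs3) hm).
rewrite e123 eqxx implyTb => /negP; apply.
apply/dvd9P; rewrite -[X in edvd _ X]subr0 -e0.
have -> : e1 * s1 + e2 * (m * s2) + e3 * (beta * s3)
   - (e1 * x ^+ 3 + e2 * (n%:R * y ^+ 3) + e3 * (beta * z ^+ 3))
  = - (e1 * (x ^+ 3 - s1) + (e2 * m * (y ^+ 3 - s2)
    + e2 * y ^+ 3 * (n%:R - m)) + e3 * (beta * (z ^+ 3 - s3))).
  by ring.
by apply/edvdN/edvdD; [apply/edvdD => //; try apply/edvdD|]; apply: edvd_mull.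
Qed.

(** * The descent *)

(** The linear factors of x^3 + y^3, scaled by powers of w to have sum zero, are congruent modulo
    beta because w is 1 there. As beta divides their product, it divides each of them. *)
Lemma cubes_sol q x y z : edvd beta q -> x ^+ 3 + y ^+ 3 = q * z ^+ 3 ->
  z != 0 -> exists a b c,
  [/\ sol q a b c z, edvd beta a & edvd beta b].
Proof.
move=> bq e z0.
have w0 : omega ^+ 2 + omega + 1 = 0 by apply: eis_eq.
have bw1 : omega - 1 = (1 + omega) * beta by apply: eis_eq.
have bw2 : - (2%:R + omega) = omega * beta by apply: eis_eq.
(* From here [ring] sees a variable [t], known only through these three relations. *)
move: omega w0 bw1 bw2 => t w0 bw1 bw2.
pose a := x + y; pose b := t * x - (1 + t) * y.
pose c := - (1 + t) * x + t * y.
have abc : a * b * c = x ^+ 3 + y ^+ 3.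
  transitivity (x ^+ 3 + y ^+ 3
    - (t ^+ 2 + t + 1) * ((x + y) * (x - y) ^+ 2)).
    by rewrite /a /b /c; ring.
  by rewrite w0 mul0r subr0.
have ba_b : edvd beta (b - a).
  have -> : b - a = (t - 1) * x + - (2%:R + t) * y by rewrite /a /b; ring.
  by rewrite bw1 bw2; apply: edvdD; apply/edvd_mulr/edvd_mull/edvdxx.
have ba_c : edvd beta (c - a).
  have -> : c - a = - (2%:R + t) * x + (t - 1) * y by rewrite /a /c; ring.
  by rewrite bw1 bw2; apply: edvdD; apply/edvd_mulr/edvd_mull/edvdxx.
have [_ _ bp] := beta_prime.
have ba : edvd beta a.
  have [/bp[//|h]|h] : edvd beta (a * b) \/ edvd beta c.
  - by apply: bp; rewrite abc e; apply: edvd_mulr.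
  - by rewrite -[a](subKr b); apply: edvdD => //; apply: edvdN.
  - by rewrite -[a](subKr c); apply: edvdD => //; apply: edvdN.
exists a, b, c; split=> //; last by rewrite -[b](subrK a); apply: edvdD.
by split; [rewrite /a /b /c; ring|rewrite abc|].
Qed.

Lemma descent_coprime (p k : nat) q a b c d :
    prime p -> p = 2 %[mod 3] -> (k <= 2)%N ->
    (p ^ k %% 9)%N \in [:: 2; 4; 5; 7]%N ->
    q = beta * p%:R ^+ k -> sol q a b c d -> edvd beta c ->
    coprime_pair a b -> coprime_pair a c -> coprime_pair b c ->
  exists a' b' c' d', sol q a' b' c' d' /\ norm d' < norm d.
Proof.
move=> pp p3 k2 r9 eq [s0 e d0] bc cab cac cbc.
have bp := beta_prime; have ip := inert_prime pp p3.
have [b0 _ bP] := bp; have [_ _ pP] := ip.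
have cq := cubefree_beta_pow pp p3 k2; rewrite -eq in cq.
have [a1 [b1 [c1 [x [y [z [ea eb ec e1 ed]]]]]]] :=
  coprime_cube_split cab cac cbc e d0.
have na : ~ edvd beta a by move=> h; apply: (cac _ bp).
have nb : ~ edvd beta b by move=> h; apply: (cbc _ bp).
have a1a : edvd a1 a by rewrite ea; apply/edvd_mulr/edvdxx.
have b1b : edvd b1 b by rewrite eb; apply/edvd_mulr/edvdxx.
have c1c : edvd c1 c by rewrite ec; apply/edvd_mulr/edvdxx.
have nx : ~ edvd beta x.
  by move=> h; apply: na; rewrite ea !exprS; apply/edvd_mull/edvd_mulr.
have ny : ~ edvd beta y.
  by move=> h; apply: nb; rewrite eb !exprS; apply/edvd_mull/edvd_mulr.
(* The factor beta of [q] can only sit in the coefficient of [c]. *)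
have [c2 ec2] : edvd beta c1.
  have [/bP[] h|//] : edvd beta (a1 * b1) \/ edvd beta c1.
  - by apply: bP; rewrite e1 eq; apply/edvd_mulr/edvdxx.
  - by case: na; apply: edvd_trans a1a.
  - by case: nb; apply: edvd_trans b1b.
have c2c : edvd c2 c.
  by apply: edvd_trans c1c; rewrite ec2; apply/edvd_mulr/edvdxx.
have {}e1 : a1 * b1 * c2 = p%:R ^+ k.
  by apply: (mulIf b0); rewrite [RHS]mulrC -eq -e1 ec2; ring.
have z0 : z != 0 by apply: contraNneq d0 => h; rewrite ed h mulr0.
have xy0 : x * y != 0 by apply: contraNneq d0 => h; rewrite ed h mul0r.
(* By coprimality at most one of [a1], [b1], [c2] is divisible by p; the other two are units, and
   that one takes all of p^k. *)
have unit_a1 : ~ edvd p%:R a1 -> a1 \is a GRing.unit.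
  by apply: (prime_cofactor_unit ip (y := b1 * c2) (n := k)); rewrite -e1; ring.
have unit_b1 : ~ edvd p%:R b1 -> b1 \is a GRing.unit.
  by apply: (prime_cofactor_unit ip (y := a1 * c2) (n := k)); rewrite -e1; ring.
have unit_c2 : ~ edvd p%:R c2 -> c2 \is a GRing.unit.
  by apply: (prime_cofactor_unit ip (y := a1 * b1) (n := k)); rewrite -e1; ring.
(* If p divides [a1] or [b1], the coefficients form the pattern that [mod9_p] excludes. *)
have [pa|/unit_a1 ua] := EM (edvd p%:R a1).
  have ub : b1 \is a GRing.unit.
    by apply: unit_b1 => pb; apply: (cab _ ip); split;
      [apply: edvd_trans a1a|apply: edvd_trans b1b].
  have uc : c2 \is a GRing.unit.
    by apply: unit_c2 => pc; apply: (cac _ ip); split;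
      [apply: edvd_trans a1a|apply: edvd_trans c2c].
  have ea1 : a1 = (b1^-1 * c2^-1) * p%:R ^+ k.
    rewrite -e1; transitivity (a1 * (b1^-1 * b1) * (c2^-1 * c2)); last by ring.
    by rewrite !mulVr // !mulr1.
  case: (@mod9_p (p ^ k) b1 (b1^-1 * c2^-1) c2 y x z) => //.
  - by rewrite unitrM !unitrV ub.
  - by rewrite mulrA divrr // mul1r mulVr.
  - by rewrite -[RHS]s0 ea eb ec ec2 {1}ea1 natrX; ring.
have [pb|/unit_b1 ub] := EM (edvd p%:R b1).
  have uc : c2 \is a GRing.unit.
    by apply: unit_c2 => pc; apply: (cbc _ ip); split;
      [apply: edvd_trans b1b|apply: edvd_trans c2c].
  have eb1 : b1 = (a1^-1 * c2^-1) * p%:R ^+ k.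
    rewrite -e1; transitivity (b1 * (a1^-1 * a1) * (c2^-1 * c2)); last by ring.
    by rewrite !mulVr // !mulr1.
  case: (@mod9_p (p ^ k) a1 (a1^-1 * c2^-1) c2 x y z) => //.
  - by rewrite unitrM !unitrV ua.
  - by rewrite mulrA divrr // mul1r mulVr.
  - by rewrite -[RHS]s0 ea eb ec ec2 {1}eb1 natrX; ring.
have ec2' : c2 = (a1^-1 * b1^-1) * p%:R ^+ k.
  rewrite -e1; transitivity (c2 * (a1^-1 * a1) * (b1^-1 * b1)); last by ring.
  by rewrite !mulVr // !mulr1.
set e3 := a1^-1 * b1^-1 in ec2'.
have ec3 : c = e3 * (q * z ^+ 3) by rewrite ec ec2 ec2' eq; ring.
have [b1_in e3_in] : b1 \in [:: a1; - a1] /\ e3 \in [:: a1; - a1].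
  apply: (@mod9_beta_p (p ^ k) a1 b1 e3 x y z) => //.
  - transitivity ((a1 * a1^-1) * (b1 * b1^-1)); first by rewrite /e3; ring.
    by rewrite !divrr // mulr1.
  - by rewrite -[RHS]s0 ea eb ec3 eq natrX; ring.
have a10 : a1 != 0 by apply: contraTneq ua => ->; rewrite unitr0.
(* The remaining signs are cubes and are absorbed into [y] and [z]. *)
have [y' [z' [eyz [ny' nz']]]] : exists y' z', x ^+ 3 + y' ^+ 3 = q * z' ^+ 3 /\
    (y' = y \/ y' = - y) /\ (z' = z \/ z' = - z).
  have key : a1 * x ^+ 3 + b1 * y ^+ 3 + e3 * (q * z ^+ 3) = 0.
    by rewrite -ea -eb -ec3.
  have cancel y' z' : a1 * x ^+ 3 + a1 * y' ^+ 3 - a1 * (q * z' ^+ 3) = 0 ->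
      x ^+ 3 + y' ^+ 3 = q * z' ^+ 3.
    move=> h; apply: (mulfI a10); apply/eqP; rewrite -subr_eq0 -[X in _ == X]h.
    by apply/eqP; ring.
  move: b1_in e3_in; rewrite !inE => /orP[]/eqP hb /orP[]/eqP he.
  - exists y, (- z); split; last by split; [left|right].
    by apply: cancel; rewrite -[RHS]key hb he; ring.
  - exists y, z; split; last by split; left.
    by apply: cancel; rewrite -[RHS]key hb he; ring.
  - exists (- y), (- z); split; last by split; right.
    by apply: cancel; rewrite -[RHS]key hb he; ring.
  - exists (- y), z; split; last by split; [right|left].
    by apply: cancel; rewrite -[RHS]key hb he; ring.
have bq : edvd beta q by rewrite eq; apply/edvd_mulr/edvdxx.
have z'0 : z' != 0 by case: nz' => ->; rewrite ?oppr_eq0.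
(* The triple built on [z'] has two entries divisible by beta. Removing beta makes the norm strictly
   smaller than that of [z], a divisor of [d]. *)
have [a' [b' [c' [s ba bb]]]] := cubes_sol bq eyz z'0.
have [a'' [b'' [c'' [d'' [s' l]]]]] := sol_common_prime cq bp s ba bb.
exists a'', b'', c'', d''; split=> //; apply: (lt_le_trans l).
have -> : norm z' = norm z by case: nz' => ->; rewrite /norm ?eisE //; ring.
by rewrite ed normM ler_peMl ?norm_ge0 // -gtz0_ge1 norm_gt0.
Qed.

Lemma no_sol (p k : nat) a b c d :
    prime p -> p = 2 %[mod 3] -> (k <= 2)%N ->
    (p ^ k %% 9)%N \in [:: 2; 4; 5; 7]%N ->
  ~ sol (beta * p%:R ^+ k) a b c d.
Proof.
move=> pp p3 k2 r9.
have [n] := ubnP `|norm d|%N; elim: n => // n IH in a b c d *.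
move=> ltn s; set q := beta * _ in s IH.
have cq : cubefree q by exact: cubefree_beta_pow.
suff [a' [b' [c' [d' [s' l]]]]] :
    exists a' b' c' d', sol q a' b' c' d' /\ norm d' < norm d.
  by apply: (IH a' b' c' d') => //; move: (norm_ge0 d') (norm_ge0 d) ltn l; lia.
have [[r [pr [ra rb]]]|nc] :=
    EM (exists r, is_prime r /\ edvd r a /\ edvd r b).
  exact: (sol_common_prime cq pr s).
have [s0 e d0] := s.
have cab : coprime_pair a b by move=> r pr h; apply: nc; exists r.
have cac : coprime_pair a c.
  move=> r pr [ra rc]; apply: (cab r pr); split=> //.
  have -> : b = - (a + c) by rewrite -[LHS]subr0 -s0; ring.
  by apply/edvdN/edvdD.
have cbc : coprime_pair b c.
  move=> r pr [rb rc]; apply: (cab r pr); split=> //.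
  have -> : a = - (b + c) by rewrite -[LHS]subr0 -s0; ring.
  by apply/edvdN/edvdD.
have sw x y : coprime_pair x y -> coprime_pair y x.
  by move=> h r ps [sx sy]; apply: (h r ps).
have [_ _ bP] := beta_prime.
(* Permute the triple so that its last entry is the multiple of beta. *)
have [/bP[ba|bb]|bc] : edvd beta (a * b) \/ edvd beta c.
- by apply: bP; rewrite e; apply/edvd_mulr/edvd_mulr/edvdxx.
- apply: (@descent_coprime p k q b c a d) => //; try exact: sw.
  by split=> //; [rewrite -s0|rewrite -e]; ring.
- apply: (@descent_coprime p k q c a b d) => //; try exact: sw.
  by split=> //; [rewrite -s0|rewrite -e]; ring.
exact: (@descent_coprime p k q a b c d).
Qed.

(** * Passage from the field K to Eisenstein integers *)

Definition eval (F : pzRingType) (u : F) (x : eis) : F :=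
  (re x)%:~R + (im x)%:~R * u.

Lemma evalD (F : pzRingType) (u : F) x y :
  eval u (x + y) = eval u x + eval u y.
Proof. by rewrite /eval !eisE !intrD mulrDl addrACA. Qed.

Lemma evalM (F : comPzRingType) (u : F) x y : u ^+ 2 + u + 1 = 0 ->
  eval u (x * y) = eval u x * eval u y.
Proof.
move=> hu; rewrite /eval !eisE !(intrD, intrN, intrM, intrB).
apply/eqP; rewrite -subr_eq0; apply/eqP.
transitivity (- ((im x)%:~R * (im y)%:~R * (u ^+ 2 + u + 1))); first by ring.
by rewrite hu mulr0 oppr0.
Qed.

Lemma evalX (F : comPzRingType) (u : F) x n : u ^+ 2 + u + 1 = 0 ->
  eval u (x ^+ n) = eval u x ^+ n.
Proof.
move=> hu; elim: n => [|n IH]; first by rewrite !expr0 /eval mul0r addr0.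
by rewrite !exprS evalM // IH.
Qed.

(** An element of the kernel, multiplied by its conjugate, gives its norm, an integer that vanishes
    in characteristic 0. *)
Lemma eval_inj (F : numDomainType) (u : F) : u ^+ 2 + u + 1 = 0 ->
  injective (eval u).
Proof.
move=> hu x y e; apply/eqP; rewrite -subr_eq0; apply/eqP.
have : eval u (x - y) = 0.
  by apply: (addIr (eval u y)); rewrite -evalD subrK add0r.
move: (x - y) => {e x y} z ez.
have : eval u (z * conj z) = 0 by rewrite evalM // ez mul0r.
rewrite mul_conj /eval /= mul0r addr0 => /eqP.
by rewrite intr_eq0 norm_eq0 => /eqP.
Qed.

Lemma ratr_denq (F : numFieldType) (r : rat) :
  ratr r * (denq r)%:~R = (numq r)%:~R :> F.
Proof.
by have := congr1 (@ratr F) (numqE r); rewrite rmorphM /= !ratr_int => ->.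
Qed.

Lemma in_K_clear_denominator (R : realType) (u v z : R[i]) :
  v = -1 - u -> in_K u v z ->
  exists2 n : int, n != 0 & exists t, n%:~R * z = eval u t.
Proof.
move=> -> [a [b [c ->]]]; exists (denq a * denq b * denq c).
  by rewrite !mulf_neq0.
(* With v = -1 - u the element is (a - c) + (b - c) u; multiply by the three denominators. *)
exists (Eis (numq a * denq b * denq c - numq c * denq a * denq b)
            (numq b * denq a * denq c - numq c * denq a * denq b)).
by rewrite /eval /= !(intrD, intrN, intrM, intrB) -!ratr_denq; ring.
Qed.

Lemma two_roots_opp (R : realType) (u v : R[i]) : are_the_two_roots u v ->
  u ^+ 2 + u + 1 = 0 /\ v = -1 - u.
Proof.
move=> huv; have hu : u ^+ 2 + u + 1 = 0 by apply/huv; left.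
split=> //; have : (-1 - u) ^+ 2 + (-1 - u) + 1 = 0 by rewrite -hu; ring.
move/huv => [e|//].
have : 3%:R = 0 :> R[i].
  (* The discriminant: 4 (u^2 + u + 1) - (2 u + 1)^2 = 3, so a double root would give 3 = 0. *)
  transitivity (4%:R * (u ^+ 2 + u + 1) - (u - (-1 - u)) ^+ 2); first by ring.
  by rewrite hu e subrr; ring.
by move/eqP; rewrite pnatr_eq0.
Qed.

Lemma not_sum_of_two_cubes (R : realType) (u v : R[i]) (p k : nat) :
    are_the_two_roots u v -> prime p -> p = 2 %[mod 3] -> (k <= 2)%N ->
    (p ^ k %% 9)%N \in [:: 2; 4; 5; 7]%N ->
  ~ sum_of_two_cubes_in (in_K u v) ((u - v) * p%:R ^+ k).
Proof.
move=> /two_roots_opp[hu ev] pp p3 k2 r9 [x [y [Kx Ky e]]].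
have [n n0 [s es]] := in_K_clear_denominator ev Kx.
have [m m0 [t et]] := in_K_clear_denominator ev Ky.
have eval_int (j : int) : eval u (Eis j 0) = j%:~R.
  by rewrite /eval mul0r addr0.
have eval_beta : eval u beta = u - v by rewrite ev /eval /=; ring.
have eval_nat : eval u p%:R = p%:R by rewrite /eval !eisE mul0r addr0.
(* Clearing both denominators multiplies the equation by (n m)^3. *)
pose d := Eis (n * m) 0.
have d0 : d != 0.
  by rewrite -norm_eq0 /norm /=; apply/eqP; have := mulf_neq0 n0 m0; nia.
have eq : (Eis m 0 * s) ^+ 3 + (Eis n 0 * t) ^+ 3 =
    beta * p%:R ^+ k * d ^+ 3.
  apply: (eval_inj hu); rewrite evalD !(evalM, evalX) // !eval_int -es -et.
  by rewrite eval_beta eval_nat e intrM; ring.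
have bq : edvd beta (beta * p%:R ^+ k) by apply/edvd_mulr/edvdxx.
have [a [b [c [sol_abc _ _]]]] := cubes_sol bq eq d0.
exact: no_sol pp p3 k2 r9 sol_abc.
Qed.

Theorem theorem2p1 (R : realType) (u v : R[i])
    (huv : are_the_two_roots u v)
    (p : nat) (p_prime : prime p)
    (p_mod9 : p = 2 %[mod 9] \/ p = 5 %[mod 9]) :
  let beta := u - v in
  ~ sum_of_two_cubes_in (in_K u v) (beta * p%:R) /\
  ~ sum_of_two_cubes_in (in_K u v) (beta * p%:R ^+ 2).
Proof.
have p3 : p = 2 %[mod 3] by lia.
have r1 : (p ^ 1 %% 9)%N \in [:: 2; 4; 5; 7]%N.
  by rewrite expn1; case: p_mod9 => ->.
have r2 : (p ^ 2 %% 9)%N \in [:: 2; 4; 5; 7]%N.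
  by rewrite -modnXm; case: p_mod9 => ->.
split; last exact: not_sum_of_two_cubes huv p_prime p3 _ r2.
rewrite -[p%:R]expr1.
exact: not_sum_of_two_cubes huv p_prime p3 _ r1.
Qed.
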